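(* For every positive integer $t$ there is a constant $c_t>0$ such that for every integer $d\ge1$ and every $\epsilon>0$, any $\epsilon$-approximate spherical $2t$-design in $\mathbb{R}^d$ has at least $$c_t\,\frac{d^{2t}}{d^t+\epsilon^2 d^{t-1}}$$ points.
   Context: Let $\mu$ be the Lebesgue (surface) measure on the unit sphere $S^{d-1}\subset\mathbb{R}^d$ normalized so that $\mu(S^{d-1})=1$, and let $\|f\|_2=\left(\int_{S^{d-1}}|f|^2\,d\mu\right)^{1/2}$. A finite nonempty set $X\subset S^{d-1}$ is an $\epsilon$-approximate spherical $s$-design in $\mathbb{R}^d$ if $\left|\frac{1}{|X|}\sum_{x\in X}f(x)-\int_{S^{d-1}}f\,d\mu\right|\le\epsilon\|f\|_2$ for every polynomial $f$ of degree at most $s$. *)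

(* Defs.v *)
From HB Require Import structures.
From mathcomp Require Import all_boot all_order all_algebra finmap.
(* The notations of mpoly clash with those of MathComp-Analysis. *)
From mathcomp Require Import -(notations) mpoly.
From mathcomp Require Import all_classical all_reals all_analysis.
From mathcomp Require Import measurable_realfun lra.

Set Implicit Arguments.
Unset Strict Implicit.
Unset Printing Implicit Defensive.

Import Order.TTheory GRing.Theory Num.Theory.
Import numFieldNormedType.Exports.

Local Open Scope classical_set_scope.
Local Open Scope ring_scope.

Section lebesgue_cons.
Context {R : realType} (n : nat).
Variable m : {sigma_finite_measure set (n.-tuple R) -> \bar R}.

Let glue (p : measurableTypeR R * n.-tuple R) : n.+1.-tuple R :=
  [tuple of p.1 :: p.2].

Let unglue (x : n.+1.-tuple R) : measurableTypeR R * n.-tuple R :=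
  (thead x, [tuple of behead x]).

Let glueK : cancel glue unglue.
Proof. by case=> a x; rewrite /unglue/=; congr pair; exact: val_inj. Qed.

Definition lebesgue_cons : set (n.+1.-tuple R) -> \bar R :=
  pushforward (lebesgue_measure \x m)%E glue.

Let measurable_glue : measurable_fun setT glue.
Proof. by apply: measurable_cons. Qed.

Let measurable_unglue : measurable_fun setT unglue.
Proof.
apply: measurable_fun_pair; first exact: measurable_tnth.
exact: measurable_behead.
Qed.

Let lebesgue_cons0 : lebesgue_cons set0 = 0%E.
Proof. by rewrite /lebesgue_cons /pushforward preimage_set0 measure0. Qed.

Let lebesgue_cons_ge0 A : (0 <= lebesgue_cons A)%E.
Proof. exact: measure_ge0. Qed.

Let lebesgue_cons_sigma_additive : semi_sigma_additive lebesgue_cons.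
Proof.
exact: measure_semi_sigma_additive.
Qed.

HB.instance Definition _ := isMeasure.Build _ _ _ lebesgue_cons
  lebesgue_cons0 lebesgue_cons_ge0 lebesgue_cons_sigma_additive.

Let lebesgue_cons_sigma_finite : sigma_finite setT lebesgue_cons.
Proof.
have /sigma_finiteP[F [TF ndF Foo]] := sigma_finiteT (@lebesgue_measure R).
have /sigma_finiteP[G [TG ndG Goo]] := sigma_finiteT m.
exists (fun i => unglue @^-1` (F i `*` G i)).
  rewrite -preimage_bigcup -(preimage_setT unglue); congr (_ @^-1` _).
  rewrite -setXTT TF TG; apply/seteqP; split=> -[x y].
    move=> [/= [i _ Fx] [j _ Gy]]; exists (maxn i j) => //; split.
    - by move: x Fx; exact/subsetPset/ndF/leq_maxl.
    - by move: y Gy; exact/subsetPset/ndG/leq_maxr.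
  by move=> [i _ [/= Fx Gy]]; split; exists i.
move=> i; have [[mF Fi] [mG Gi]] := (Foo i, Goo i); split.
  rewrite -[X in measurable X]setTI.
  by apply: measurable_unglue => //; exact: measurableX.
rewrite /lebesgue_cons /pushforward -comp_preimage.
rewrite (_ : unglue \o glue = id); last exact/funext.
rewrite product_measure1E// lte_mul_pinfty//.
by rewrite ge0_fin_numE.
Qed.

HB.instance Definition _ := Measure_isSigmaFinite.Build _ _ _ lebesgue_cons
  lebesgue_cons_sigma_finite.

End lebesgue_cons.

(* Lebesgue measure on R^n, on the product Borel sigma-algebra of
   n.-tuple R: the n-fold product of the Lebesgue measure on R. *)
Fixpoint lebesgue_tuple {R : realType} (n : nat) :
    {sigma_finite_measure set (n.-tuple R) -> \bar R} :=
  match n with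
  | 0 => dirac ([tuple] : 0.-tuple R)
  | n'.+1 => lebesgue_cons (lebesgue_tuple n')
  end.

Section sphere.
Context {R : realType} (n : nat).
Implicit Types (x : n.-tuple R) (A : set (n.-tuple R)).

Definition enorm x : R := Num.sqrt (\sum_(i < n) tnth x i ^+ 2).

Definition unit_sphere : set (n.-tuple R) := [set x | enorm x = 1].

Definition unit_ball : set (n.-tuple R) := [set x | enorm x <= 1].

Definition radial x : n.-tuple R := [tuple tnth x i / enorm x | i < n].

Lemma measurable_enorm : measurable_fun setT enorm.
Proof.
have msqrt : measurable_fun setT (@Num.sqrt R).
  by apply: continuous_measurable_fun; exact: sqrt_continuous.
apply: (measurableT_comp msqrt).
by apply: measurable_sum => i; apply: measurable_funX; exact: measurable_tnth.
Qed.

Lemma measurable_unit_ball : measurable unit_ball.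
Proof.
rewrite (_ : unit_ball = setT `&` enorm @^-1` `]-oo, 1%R]).
  exact: measurable_enorm.
by apply/seteqP; split=> x /=; rewrite in_itv/=; [split|case].
Qed.

Lemma measurable_radial : measurable_fun setT radial.
Proof.
apply/measurable_fun_tnthP => i.
rewrite (_ : _ \o _ = fun x => tnth x i * enorm x `^ (-1)); last first.
  by apply/funext => x; rewrite /= tnth_mktuple powR_inv1 ?sqrtr_ge0.
apply: measurable_funM; first exact: measurable_tnth.
exact: (measurableT_comp (measurable_powR _) measurable_enorm).
Qed.

(* The Lebesgue measure of the cone {r u | 0 < r <= 1, u in A} over a subset A
   of the unit sphere. *)
Definition cone_measure A : \bar R :=
  lebesgue_tuple n (radial @^-1` A `&` unit_ball).

Let cone_measure0 : cone_measure set0 = 0%E.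
Proof. by rewrite /cone_measure preimage_set0 set0I measure0. Qed.

Let cone_measure_ge0 A : (0 <= cone_measure A)%E.
Proof. exact: measure_ge0. Qed.

Let cone_measure_sigma_additive : semi_sigma_additive cone_measure.
Proof.
have mradial := measurable_radial.
rewrite (_ : cone_measure =
  pushforward (mrestr (lebesgue_tuple n) measurable_unit_ball) radial) //.
exact: measure_semi_sigma_additive.
Qed.

HB.instance Definition _ := isMeasure.Build _ _ _ cone_measure
  cone_measure0 cone_measure_ge0 cone_measure_sigma_additive.

(* The normalized surface measure of A: the proportion of the unit ball that is
   covered by the cone over A. *)
Definition sphere_measure A : \bar R :=
  (((fine (lebesgue_tuple n unit_ball))^-1)%:E * cone_measure A)%E.

Let c_ge0 : 0 <= (fine (lebesgue_tuple n unit_ball))^-1.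
Proof. by rewrite invr_ge0 fine_ge0. Qed.

Let sphere_measureE : sphere_measure = mscale (NngNum c_ge0) cone_measure.
Proof. by []. Qed.

Let sphere_measure0 : sphere_measure set0 = 0%E.
Proof. by rewrite sphere_measureE measure0. Qed.

Let sphere_measure_ge0 A : (0 <= sphere_measure A)%E.
Proof. by rewrite sphere_measureE measure_ge0. Qed.

Let sphere_measure_sigma_additive : semi_sigma_additive sphere_measure.
Proof. by rewrite sphere_measureE; exact: measure_semi_sigma_additive. Qed.

HB.instance Definition _ := isMeasure.Build _ _ _ sphere_measure
  sphere_measure0 sphere_measure_ge0 sphere_measure_sigma_additive.

End sphere.
Arguments unit_sphere {R} n.
Arguments unit_ball {R} n.
Arguments sphere_measure {R} n.

Section sphere_measure_unit_sphere.
Context {R : realType}.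

Let box (n : nat) (a b : R) : set (n.-tuple R) :=
  [set x | forall i, a <= tnth x i <= b].

Let measurable_box (n : nat) (a b : R) : measurable (@box n a b).
Proof.
rewrite (_ : @box n a b =
    \bigcap_(i in [set: 'I_n]) ((@tnth n R)^~ i @^-1` `[a, b])).
  apply: fin_bigcap_measurable => // i _; rewrite -[X in measurable X]setTI.
  exact: (measurable_tnth i).
by apply/seteqP; split=> x bx i; [move=> _|]; have := bx i;
  rewrite /= in_itv//=; apply.
Qed.

Let lebesgue_box (n : nat) (a b : R) : a <= b ->
  lebesgue_tuple n (@box n a b) = ((b - a) ^+ n)%:E.
Proof.
move=> ab; elim: n => [|n IHn].
  by rewrite expr0 /= diracE mem_set// => -[].
rewrite /= /lebesgue_cons /pushforward.
rewrite (_ : _ @^-1` _ = `[a, b] `*` @box n a b).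
  rewrite product_measure1E//; last exact: measurable_box.
  rewrite IHn /= (_ : lebesgue_measure _ = (b - a)%:E) -?EFinM -?exprS//.
  rewrite -[LHS]/(lebesgue_measure ([set` `[a, b]] : set R)).
  rewrite lebesgue_measure_itv/= lte_fin.
  have [//|ba] := ltP a b; rewrite (_ : b = a) ?subrr//.
  by apply/eqP; rewrite eq_le ab ba.
apply/seteqP; split=> -[y x] /= h.
  split.
    by have := h ord0; rewrite in_itv/= tnth0.
  by move=> i; have := h (lift ord0 i); rewrite tnthS.
case: h; rewrite in_itv/= => hy hx i.
by have [j ->|->] := unliftP ord0 i; rewrite ?tnthS ?tnth0.
Qed.

Let tnth_le_enorm (n : nat) (x : n.-tuple R) i : `|tnth x i| <= enorm x.
Proof.
rewrite -sqrtr_sqr ler_wsqrtr// (bigD1 i)//= lerDl.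
by apply: sumr_ge0 => j _; exact: sqr_ge0.
Qed.

Let unit_ball_box (n : nat) : unit_ball n `<=` @box n (-1 : R) 1.
Proof.
move=> x x1 i; rewrite -ler_norml.
exact: le_trans (tnth_le_enorm x i) x1.
Qed.

Let box_unit_ball (n : nat) :
  @box n (- (n.+1%:R)^-1 : R) (n.+1%:R)^-1 `<=` unit_ball n.
Proof.
move=> x bx; rewrite /unit_ball /= -[leRHS]sqrtr1 ler_wsqrtr//.
apply: (@le_trans _ _ (\sum_(i < n) (n.+1%:R)^-1)).
  apply: ler_sum => i _; rewrite -real_normK ?num_real//.
  have := bx i; rewrite -ler_norml => /le_trans xi.
  rewrite expr2 -[leRHS]mul1r ler_pM// ?xi//.
  by rewrite invf_le1 ?ltr0n// ler1n.
by rewrite sumr_const card_ord -[leLHS]mulr_natl ler_pdivrMr ?mul1r ?ler_nat ?ltr0n.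
Qed.

Lemma sphere_measure_unit_sphere (n : nat) : (0 < n)%N ->
  sphere_measure n (unit_sphere n) = 1%E :> \bar R.
Proof.
move=> n0.
have mB := @measurable_unit_ball R n.
have mS : measurable (unit_sphere n : set (n.-tuple R)).
  rewrite (_ : unit_sphere n = setT `&` @enorm R n @^-1` [set 1])//.
    exact: measurable_enorm.
  by rewrite setTI.
have mrS : measurable (@radial R n @^-1` unit_sphere n).
  by rewrite -[X in measurable X]setTI; exact: measurable_radial.
have Boo : (lebesgue_tuple n (@unit_ball R n) < +oo)%E.
  apply: (@le_lt_trans _ _ (lebesgue_tuple n (@box n (-1) 1))).
    apply: le_measure; rewrite ?inE//; first exact: measurable_box.
    exact: unit_ball_box.
  by rewrite lebesgue_box ?ltry//; lra.
have B0 : (0 < lebesgue_tuple n (@unit_ball R n))%E.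
  apply: (@lt_le_trans _ _ (lebesgue_tuple n
      (@box n (- (n.+1%:R)^-1) (n.+1%:R)^-1))); last first.
    apply: le_measure; rewrite ?inE//; first exact: measurable_box.
    exact: box_unit_ball.
  rewrite lebesgue_box ?lte_fin ?exprn_gt0 ?opprK ?addr_gt0 ?invr_gt0 ?ltr0n//.
  by rewrite lerNl (@le_trans _ _ 0)// ?oppr_le0 invr_ge0.
have Z0 : lebesgue_tuple n (@box n (0 : R) 0) = 0%E.
  by rewrite lebesgue_box// subrr expr0n gtn_eqF.
have BE : cone_measure (unit_sphere n) = lebesgue_tuple n (@unit_ball R n).
  apply/eqP; rewrite eq_le; apply/andP; split.
    apply: le_measure; rewrite ?inE//; exact: measurableI.
  rewrite -[leRHS]adde0 -Z0.
  apply: le_trans (measureU2 _ _ _) => //;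
    [|exact: measurableI|exact: measurable_box].
  apply: le_measure; rewrite ?inE//.
    apply: measurableU => //; first exact: measurableI.
    exact: measurable_box.
  move=> x xB; have [x0|x0] := eqVneq (enorm x) 0.
    right=> i; have := tnth_le_enorm x i.
    by rewrite x0 normr_le0 => /eqP ->; rewrite lexx.
  left; split => //=; rewrite /unit_sphere /= /enorm.
  under eq_bigr do rewrite tnth_mktuple exprMn.
  rewrite -mulr_suml exprVn sqr_sqrtr; last first.
    by apply: sumr_ge0 => j _; exact: sqr_ge0.
  rewrite divff ?sqrtr1//; apply: contra x0 => /eqP.
  by rewrite /enorm => ->; rewrite sqrtr0.
rewrite /sphere_measure BE -[X in (_ * X)%E]fineK ?ge0_fin_numE//.
by rewrite -EFinM mulVf// gt_eqF// fine_gt0// B0.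
Qed.

End sphere_measure_unit_sphere.

Section approximate_design.
Context {R : realType} (d : nat).

Definition L2_norm (f : d.-tuple R -> R) : R :=
  Num.sqrt (\int[sphere_measure d]_(x in unit_sphere d) (`|f x| ^+ 2)).

(* mmeasure (@mdeg d) f is the total degree of f plus 1, and 0 for f = 0. *)
Definition degree_le (s : nat) (f : mpoly d R) : Prop :=
  (mmeasure (@mdeg d) f <= s.+1)%N.

Definition approximate_design (eps : R) (s : nat) (X : {fset d.-tuple R}) :
    Prop :=
  [/\ X != fset0,
      forall x, x \in X -> unit_sphere d x
    & forall f : mpoly d R, degree_le s f ->
        let F := fun x : d.-tuple R => meval (tnth x) f in
        `| (#|` X|%:R)^-1 * \sum_(x <- X) F x
           - \int[sphere_measure d]_(x in unit_sphere d) F x |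
        <= eps * L2_norm F].

End approximate_design.

(* Main.v *)
Require Import Defs.
From HB Require Import structures.
From mathcomp Require Import all_boot all_order all_algebra finmap.
From mathcomp Require Import -(notations) mpoly.
From mathcomp Require Import all_classical all_reals all_analysis.
From mathcomp Require Import measurable_realfun zify lra ring.
Import Order.TTheory GRing.Theory Num.Theory.
Local Open Scope classical_set_scope.
Local Open Scope ring_scope.

(** Write <x, z> for the inner product, let all integrals be over the unit
sphere with its normalized measure, let N be the number of points of X, and
let m_t be the integral of <y, z>^(2t) over z, which does not depend on the
unit vector y and is of order d^(-t).  The design property is tested on one
polynomial of degree 2t,

  f(z) = 1/N * sum_(y in X) <y, z>^(2t) - m_t.

Its integral is 0 and its average over X is s - m_t, where
s = 1/N^2 * sum_(x, y in X) <x, y>^(2t).  The diagonal alone gives s >= 1/N,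
so a lower bound on N is an upper bound on s, and s - m_t <= eps * ||f||_2.
The point is that ||f||_2^2 <= C d^(-t-1) s: the inequality between arithmetic
and geometric means then gives s <= 2 m_t + eps^2 C d^(-t-1), which is the
theorem.

The norm is ||f||_2^2 = 1/N^2 * sum_(x, y in X) A(x, y) - m_t^2, where A(x, y)
is the integral of <x, z>^(2t) <y, z>^(2t).  By [moment_expansion], A is an even
polynomial in <x, y> with coefficients between 0 and C d^(-2t) and constant
coefficient at most m_t^2.  So m_t^2 absorbs the constant term, which is the
only one that would be too large, and there remain the averages over X * X of
<x, y>^(2i) for 1 <= i <= t.  Each exchange of i for i + 1 costs at most a
factor d ([power_sum_leSS]: the trace of a tensor of order 2 has norm at most
sqrt d times the norm of the tensor), so all are at most d^(t-1) s, and
d^(-2t) d^(t-1) = d^(-t-1).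

The expansion of A comes from a recursion on the exponents ([moment_rec]) that
is an integration by parts on the sphere ([sphere_int_by_parts]).  The latter
expresses that the derivative of a function along an infinitesimal rotation has
integral 0 ([sphere_int_tangent]), because the measure is invariant under
rotations; and that holds because a plane rotation is a product of three shears,
each of which preserves the Lebesgue measure by Fubini and by the invariance
under translations of the Lebesgue measure on the line. *)

(** * Shears preserve the Lebesgue measure *)

Section tail.
Context {R : realType} {n : nat}.

Definition tail (x : n.+1.-tuple R) : n.-tuple R := [tuple of behead x].

Lemma tnth_tail x i : tnth (tail x) i = tnth x (lift ord0 i).
Proof. by rewrite [in RHS](tuple_eta x) tnthS. Qed.

Lemma tail_cons a (x : n.-tuple R) : tail [tuple of a :: x] = x.
Proof. exact: val_inj. Qed.

Lemma measurable_tail : measurable_fun setT tail.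
Proof. exact: measurable_behead. Qed.

End tail.

Lemma measurable_preimage d d' (T : measurableType d) (U : measurableType d')
    (f : T -> U) (A : set U) :
  measurable_fun setT f -> measurable A -> measurable (f @^-1` A).
Proof. by move=> mf mA; rewrite -[X in measurable X]setTI; exact: mf. Qed.
Arguments measurable_preimage {d d' T U f A}.

Section measure_preserving.
Context {R : realType}.

Lemma lebesgue_measure_translate (a : R) (A : set (measurableTypeR R)) :
  measurable A ->
  lebesgue_measure ((fun x : measurableTypeR R => x + a : measurableTypeR R)
    @^-1` A) = lebesgue_measure A.
Proof.
have mf : measurable_fun setT
    (fun x : measurableTypeR R => x + a : measurableTypeR R).
  exact: measurable_funD.
move=> mA; apply/esym.
apply: (@lebesgue_measure_unique R (pushforward lebesgue_measure
  (fun x : measurableTypeR R => x + a : measurableTypeR R))) => //.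
move=> _ [[b c]] _ <-; rewrite /= /pushforward.
rewrite (_ : _ @^-1` _ = `]b - a, c - a]%classic); last first.
  by apply/seteqP; split=> x /=; rewrite !in_itv/= ltrBlDr lerBrDr.
rewrite !lebesgue_measure_itv/= !lte_fin ltrD2r -!EFinB.
by rewrite (_ : c - a - (b - a) = c - b)//; ring.
Qed.

Definition preserving n (T : n.-tuple R -> n.-tuple R) :=
  measurable_fun setT T /\
  forall A, measurable A -> lebesgue_tuple n (T @^-1` A) = lebesgue_tuple n A.

Lemma preserving_comp n (T U : n.-tuple R -> n.-tuple R) :
  preserving n T -> preserving n U -> preserving n (T \o U).
Proof.
move=> [mT pT] [mU pU]; split; first exact: measurableT_comp.
move=> A mA; rewrite comp_preimage pU ?pT//.
exact: (measurable_preimage mT mA).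
Qed.

Let measurable_glue n : measurable_fun setT
  (fun p : measurableTypeR R * n.-tuple R => [tuple of p.1 :: p.2]).
Proof. exact: measurable_cons. Qed.

Let measurable_thead n : measurable_fun setT
  (fun x : n.+1.-tuple R => thead x : measurableTypeR R).
Proof. exact: measurable_tnth. Qed.

(** Fubini, integrating the tail first: on each slice with fixed head the map
acts by a transformation of the tail that preserves the measure. *)
Lemma preserving_tail n (T : R -> n.-tuple R -> n.-tuple R) :
  measurable_fun setT
    (fun p : measurableTypeR R * n.-tuple R => T p.1 p.2) ->
  (forall a, preserving n (T a)) ->
  preserving n.+1
    (fun x => [tuple of thead x :: T (thead x) (tail x)]).
Proof.
move=> mT pT.
have mS : measurable_fun setT (fun x : n.+1.-tuple R =>
    [tuple of thead x :: T (thead x) (tail x)]).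
  have mg : measurable_fun setT (fun x : n.+1.-tuple R =>
      (thead x : measurableTypeR R, tail x)).
    exact: (measurable_fun_pair (measurable_thead n) measurable_tail).
  exact: (measurable_cons (measurable_thead n) (measurableT_comp mT mg)).
split=> // A mA; rewrite /= /lebesgue_cons /pushforward /product_measure1.
apply: eq_integral => a _ /=.
rewrite -[RHS](proj2 (pT a)); last first.
  apply: measurable_xsection.
  exact: (measurable_preimage (measurable_glue n) mA).
congr (lebesgue_tuple _ _); apply/seteqP; split=> y /=;
  rewrite /xsection/= !inE/=.
all: by rewrite theadE tail_cons.
Qed.

(** Fubini, integrating the head first: on each slice with fixed tail the map
is a translation of the line. *)
Lemma preserving_head n (phi : n.-tuple R -> R) : measurable_fun setT phi ->
  preserving n.+1
    (fun x => [tuple of thead x + phi (tail x) :: tail x]).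
Proof.
move=> mphi.
have mS : measurable_fun setT (fun x : n.+1.-tuple R =>
    [tuple of thead x + phi (tail x) :: tail x]).
  have mphit := measurableT_comp mphi measurable_tail.
  exact: (measurable_cons (measurable_funD (measurable_thead n) mphit)
    measurable_tail).
have pE (B : set (measurableTypeR R * n.-tuple R)) : measurable B ->
    (lebesgue_measure \x lebesgue_tuple n)%E B =
    (lebesgue_measure \x^ lebesgue_tuple n)%E B.
  move=> mB; apply: product_measure_unique => // C D mC mD.
  exact: product_measure2E.
split=> // A mA; rewrite /= /lebesgue_cons /pushforward !pE; last 2 first.
- exact: (measurable_preimage (measurable_glue n) mA).
- exact: (measurable_preimage (measurable_glue n) (measurable_preimage mS mA)).
apply: eq_integral => y _ /=.
rewrite -[RHS](@lebesgue_measure_translate (phi y)); last first.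
  apply: measurable_ysection.
  exact: (measurable_preimage (measurable_glue n) mA).
have consE (a : R) : [tuple of thead [tuple of a :: y] +
    phi (tail [tuple of a :: y]) :: tail [tuple of a :: y]] =
    [tuple of a + phi y :: y].
  by apply: val_inj; rewrite /= tail_cons theadE.
by congr (lebesgue_measure _); apply/seteqP; split=> a /=;
  rewrite /ysection/= !inE/=; move: (consE a) => /= ->.
Qed.

Lemma preserving_id n : preserving n id.
Proof. by split; first exact: measurable_id. Qed.

Definition translate n (v x : n.-tuple R) : n.-tuple R :=
  [tuple tnth x k + tnth v k | k < n].

Lemma preserving_translate n (v : n.-tuple R) : preserving n (translate n v).
Proof.
elim: n v => [|n IHn] v.
  rewrite (_ : translate _ _ = id); first exact: preserving_id.
  by apply/funext => x; apply: eq_from_tnth => -[].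
rewrite (_ : translate _ _ =
  (fun x => [tuple of thead x + tnth v ord0 :: tail x]) \o
  (fun x => [tuple of thead x :: translate n (tail v) (tail x)])).
  apply: preserving_comp.
    exact: (preserving_head n (fun=> tnth v ord0)).
  apply: (preserving_tail n (fun=> translate n (tail v))) => //.
  exact: (measurableT_comp (proj1 (IHn _)) (@measurable_snd _ _ _ _)).
apply/funext => x; apply: eq_from_tnth => k; rewrite tnth_mktuple /=.
have [l ->|->] := unliftP ord0 k; last by rewrite !(tnth0, theadE).
rewrite tnthS tnth_tail /= tnthS tnth_mktuple !tnth_tail.
by [].
Qed.

Definition shear n (i j : 'I_n) (c : R) (x : n.-tuple R) : n.-tuple R :=
  [tuple tnth x k + (if k == i then c * tnth x j else 0) | k < n].

(** By induction on the dimension.  A shear within the tail is the induction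
hypothesis; one that moves the head is a translation of the head by a function
of the tail; one that moves a coordinate of the tail according to the head is,
on each slice, a translation of the tail. *)
Lemma preserving_shear n (i j : 'I_n) c : i != j ->
  preserving n (shear n i j c).
Proof.
elim: n i j => [|n IHn] i j; first by case: i.
have [i' ->|->] := unliftP ord0 i; have [j' ->|->] := unliftP ord0 j => ij.
- have ij' : i' != j' by apply: contra ij => /eqP ->.
  rewrite (_ : shear _ _ _ _ = fun x =>
    [tuple of thead x :: shear n i' j' c (tail x)]).
    apply: (preserving_tail n (fun=> shear n i' j' c)).
      exact: (measurableT_comp (proj1 (IHn i' j' ij'))
        (@measurable_snd _ _ _ _)).
    by move=> _; exact: IHn.
  apply/funext => x; apply: eq_from_tnth => k; rewrite tnth_mktuple.
  have [l ->|->] := unliftP ord0 k; last by rewrite tnth0 addr0.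
  by rewrite tnthS /shear tnth_mktuple !tnth_tail (inj_eq lift_inj).
- pose v (a : R) := [tuple if k == i' then c * a else 0 | k < n].
  rewrite (_ : shear _ _ _ _ = fun x =>
    [tuple of thead x :: translate n (v (thead x)) (tail x)]).
    apply: (preserving_tail n (fun a => translate n (v a))); last first.
      by move=> a; exact: preserving_translate.
    apply/measurable_fun_tnthP => k.
    rewrite (_ : _ \o _ = fun p : measurableTypeR R * n.-tuple R =>
        tnth p.2 k + (if k == i' then c * p.1 else 0)); last first.
      by apply/funext => p; rewrite /= /translate /v !tnth_mktuple.
    apply: measurable_funD.
      exact: (measurableT_comp (measurable_tnth k) (@measurable_snd _ _ _ _)).
    case: (k == i') => //; apply: measurable_funM => //.
  apply/funext => x; apply: eq_from_tnth => k; rewrite tnth_mktuple.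
  have [l ->|->] := unliftP ord0 k; last by rewrite tnth0 addr0.
  by rewrite tnthS /translate /v !tnth_mktuple !tnth_tail (inj_eq lift_inj).
- rewrite (_ : shear _ _ _ _ = fun x =>
    [tuple of thead x + c * tnth (tail x) j' :: tail x]).
    apply: (preserving_head n (fun y => c * tnth y j')).
    by apply: measurable_funM => //; exact: measurable_tnth.
  apply/funext => x; apply: eq_from_tnth => k; rewrite tnth_mktuple.
  have [l ->|->] := unliftP ord0 k; last by rewrite tnth0 tnth_tail.
  by rewrite tnthS tnth_tail /= addr0.
- by rewrite eqxx in ij.
Qed.

End measure_preserving.

(** * Rotations preserve the measure on the sphere *)

Section rotations.
Context {R : realType} (n : nat).
Implicit Types (i j : 'I_n) (u : R) (x : n.-tuple R).

(** The rational parametrization u = tan (theta / 2) of the circle avoids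
trigonometric functions, and near u = 0 it moves with speed 2. *)
Definition givens_cos u := (1 - u ^+ 2) / (1 + u ^+ 2).
Definition givens_sin u := (2 * u) / (1 + u ^+ 2).

Lemma sqr1D_neq0 u : 1 + u ^+ 2 != 0.
Proof. by rewrite gt_eqF// ltr_pwDl// sqr_ge0. Qed.

Lemma givens_cos2Dsin2 u : givens_cos u ^+ 2 + givens_sin u ^+ 2 = 1.
Proof. by rewrite /givens_cos /givens_sin; field; exact: sqr1D_neq0. Qed.

Definition givens i j u x : n.-tuple R :=
  [tuple if k == i then givens_cos u * tnth x i - givens_sin u * tnth x j
         else if k == j then givens_sin u * tnth x i + givens_cos u * tnth x j
         else tnth x k | k < n].

(** A plane rotation is the product of three shears with coefficients
- tan (theta / 2), sin theta and - tan (theta / 2). *)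
Lemma preserving_givens i j u : i != j -> preserving n (givens i j u).
Proof.
move=> ij; have ji : j != i by rewrite eq_sym.
rewrite (_ : givens i j u =
    shear n i j (- u) \o shear n j i (givens_sin u) \o shear n i j (- u)).
  by do 2?apply: preserving_comp; exact: preserving_shear.
apply/funext => x; apply: eq_from_tnth => k.
rewrite /= /givens /shear !tnth_mktuple !eqxx (negbTE ji).
have u0 := sqr1D_neq0 u.
have [->|ki] := eqVneq k i.
  by rewrite (negbTE ij) /givens_cos /givens_sin; field.
have [->|kj] := eqVneq k j.
  by rewrite /givens_cos /givens_sin; field.
by rewrite !addr0.
Qed.

Lemma sum_sqr_givens i j u x : i != j ->
  \sum_(k < n) tnth (givens i j u x) k ^+ 2 = \sum_(k < n) tnth x k ^+ 2.
Proof.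
move=> ij; have ji : j != i by rewrite eq_sym.
rewrite (bigD1 i)//= [RHS](bigD1 i)//= (bigD1 j)//= [in RHS](bigD1 j)//=.
rewrite !addrA; congr (_ + _).
  rewrite !tnth_mktuple !eqxx (negbTE ji).
  rewrite -[RHS]mul1r -(givens_cos2Dsin2 u); ring.
apply: eq_bigr => k /andP[ki kj].
by rewrite tnth_mktuple (negbTE ki) (negbTE kj).
Qed.

Lemma enorm_givens i j u x : i != j -> enorm (givens i j u x) = enorm x.
Proof. by move=> ij; rewrite /enorm sum_sqr_givens. Qed.

Lemma radial_givens i j u x : i != j ->
  radial (givens i j u x) = givens i j u (radial x).
Proof.
move=> ij; apply: eq_from_tnth => k.
rewrite !tnth_mktuple enorm_givens//.
case: ifP => _; first by rewrite mulrBl !mulrA.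
by case: ifP => _; rewrite ?mulrDl ?mulrA.
Qed.

(** Rotations commute with the radial projection and preserve the ball, so the
invariance of the Lebesgue measure passes to the measure of cones. *)
Lemma sphere_measure_givens i j u (A : set (n.-tuple R)) : i != j ->
  measurable A -> sphere_measure n (givens i j u @^-1` A) = sphere_measure n A.
Proof.
move=> ij mA; rewrite /sphere_measure /cone_measure; congr (_ * _)%E.
have [mrot prot] := preserving_givens i j u ij.
rewrite -[RHS]prot; last first.
  apply: measurableI; last exact: measurable_unit_ball.
  exact: (measurable_preimage (@measurable_radial R n) mA).
congr (lebesgue_tuple _ _); apply/seteqP; split=> x /=;
  by rewrite /unit_ball /= radial_givens// enorm_givens.
Qed.

End rotations.

(** * Integrals over the sphere *)

Section sphere_integral.
Context {R : realType} (n : nat) (n_gt0 : (0 < n)%N).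
Implicit Types f g : n.-tuple R -> R.

Definition sphere_int f : R := \int[sphere_measure n]_(x in unit_sphere n) f x.

(** Enough for integrability on the sphere, whose measure is finite, and stable
under sums and products, which integrability is not. *)
Definition tame f := measurable_fun setT f /\
  exists M, forall x, unit_sphere n x -> `|f x| <= M.

Let mS : measurable (unit_sphere n : set (n.-tuple R)).
Proof.
rewrite (_ : unit_sphere n = @enorm R n @^-1` [set 1])//.
exact: (measurable_preimage (@measurable_enorm R n)).
Qed.

Lemma tame_integrable f : tame f ->
  (sphere_measure n).-integrable (unit_sphere n) (EFin \o f).
Proof.
move=> [mf [M fM]]; apply: measurable_bounded_integrable => //.
- by rewrite [ltLHS]sphere_measure_unit_sphere// ltry.
- exact: measurable_funTS.
- exists M; split; first exact: num_real.
  by move=> N MN x Sx /=; exact: le_trans (fM x Sx) (ltW MN).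
Qed.

Lemma tame_cst c : tame (fun=> c).
Proof. by split; [exact: measurable_cst|exists `|c|]. Qed.

Lemma tameD f g : tame f -> tame g -> tame (fun x => f x + g x).
Proof.
move=> [mf [M fM]] [mg [N gN]]; split; first exact: measurable_funD.
exists (M + N) => x Sx; apply: le_trans (ler_normD _ _) _.
by apply: lerD; [exact: fM|exact: gN].
Qed.

Lemma tameM f g : tame f -> tame g -> tame (fun x => f x * g x).
Proof.
move=> [mf [M fM]] [mg [N gN]]; split; first exact: measurable_funM.
exists (M * N) => x Sx; rewrite normrM.
by apply: ler_pM => //; [exact: fM|exact: gN].
Qed.

Lemma tameX f k : tame f -> tame (fun x => f x ^+ k).
Proof.
move=> tf; elim: k => [|k IHk]; first exact: tame_cst.
by under eq_fun do rewrite exprS; exact: tameM.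
Qed.

Lemma tame_sum (I : Type) (r : seq I) (F : I -> n.-tuple R -> R) :
  (forall i, tame (F i)) -> tame (fun x => \sum_(i <- r) F i x).
Proof.
move=> tF; elim: r => [|i r IHr].
  by under eq_fun do rewrite big_nil; exact: tame_cst.
by under eq_fun do rewrite big_cons; exact: tameD.
Qed.

Lemma norm_tnth_le1 x i : unit_sphere n x -> `|tnth x i| <= 1 :> R.
Proof.
move=> Sx; rewrite -sqrtr_sqr -[leRHS]Sx ler_wsqrtr// (bigD1 i)//= lerDl.
by apply: sumr_ge0 => j _; exact: sqr_ge0.
Qed.

Lemma tame_tnth i : tame (fun x => tnth x i).
Proof.
split; first exact: measurable_tnth.
by exists 1 => x Sx; exact: norm_tnth_le1.
Qed.

Lemma sphere_intD f g : tame f -> tame g ->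
  sphere_int (fun x => f x + g x) = sphere_int f + sphere_int g.
Proof. by move=> tf tg; apply: RintegralD => //; exact: tame_integrable. Qed.

Lemma sphere_intZ c f : tame f ->
  sphere_int (fun x => c * f x) = c * sphere_int f.
Proof. by move=> tf; apply: RintegralZl => //; exact: tame_integrable. Qed.

Lemma sphere_int_cst c : sphere_int (fun=> c) = c.
Proof.
rewrite /sphere_int Rintegral_cst//.
by rewrite [X in fine X]sphere_measure_unit_sphere//= mulr1.
Qed.

Lemma eq_sphere_int f g : (forall x, unit_sphere n x -> f x = g x) ->
  sphere_int f = sphere_int g.
Proof. by move=> fg; apply: eq_Rintegral => x; rewrite inE => /fg. Qed.

Lemma le_sphere_int f g : tame f -> tame g ->
  (forall x, unit_sphere n x -> f x <= g x) -> sphere_int f <= sphere_int g.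
Proof. by move=> tf tg; apply: le_Rintegral => //; exact: tame_integrable. Qed.

Lemma sphere_int_sum (I : Type) (r : seq I) (F : I -> n.-tuple R -> R) :
  (forall i, tame (F i)) ->
  sphere_int (fun x => \sum_(i <- r) F i x) = \sum_(i <- r) sphere_int (F i).
Proof.
move=> tF; elim: r => [|i r IHr].
  by under eq_fun do rewrite big_nil; rewrite sphere_int_cst big_nil.
under eq_fun do rewrite big_cons.
by rewrite sphere_intD// ?IHr ?big_cons//; exact: tame_sum.
Qed.

Lemma sphere_int_givens f i j u : i != j -> tame f ->
  sphere_int (f \o givens n i j u) = sphere_int f.
Proof.
move=> ij [mf [M fM]]; have [mrot _] := preserving_givens n i j u ij.
have rotS : givens n i j u @^-1` unit_sphere n = unit_sphere n.
  by apply/seteqP; split=> x; rewrite /unit_sphere /= enorm_givens.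
congr fine.
rewrite -[RHS](@eq_measure_integral _ _ _ _ (sphere_measure n)
    (pushforward (sphere_measure n) (givens n i j u))); last first.
  by move=> A mA _; exact: sphere_measure_givens.
rewrite integral_pushforward//=.
- by rewrite rotS.
- exact: measurableT_comp.
- rewrite rotS.
  have := tame_integrable (f \o givens n i j u); apply; split.
    exact: measurableT_comp.
  by exists M => x; rewrite -[in X in X -> _]rotS => /fM.
Qed.

End sphere_integral.

(** * Integrals of derivatives along rotations *)

Section infinitesimal_rotations.
Context {R : realType} (n : nat) (n_gt0 : (0 < n)%N).
Implicit Types (f g : n.-tuple R -> R) (i j k : 'I_n) (u : R) (x : n.-tuple R).

Lemma unit_sphere_givens i j u x : i != j -> unit_sphere n x ->
  unit_sphere n (givens n i j u x).
Proof. by move=> ij; rewrite /unit_sphere /= enorm_givens. Qed.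

(** A function f' with this property is the derivative of f along the rotation
in the plane of coordinates i and j.  The factor 2 is the speed of the
parametrization, and the uniformity of the error in x is what allows to
integrate the estimate. *)
Definition tangent i j f f' := [/\ tame n f, tame n f' &
  exists C, forall (u : R) x, `|u| <= 1 -> unit_sphere n x ->
    `|f (givens n i j u x) - f x - 2 * u * f' x| <= C * u ^+ 2].

Lemma tangent_cst i j c : tangent i j (fun=> c) (fun=> 0).
Proof.
split; [exact: tame_cst|exact: tame_cst|exists 0 => u x _ _].
by rewrite subrr mulr0 subrr normr0 mul0r.
Qed.

Lemma tangentD i j f f' g g' : tangent i j f f' -> tangent i j g g' ->
  tangent i j (fun x => f x + g x) (fun x => f' x + g' x).
Proof.
move=> [tf tf' [C fC]] [tg tg' [D gD]]; split; [exact: tameD|exact: tameD|].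
exists (C + D) => u x u1 Sx; rewrite [leRHS]mulrDl.
rewrite (_ : _ - _ - _ = (f (givens n i j u x) - f x - 2 * u * f' x) +
  (g (givens n i j u x) - g x - 2 * u * g' x)); last by ring.
by apply: le_trans (ler_normD _ _) _; apply: lerD; [exact: fC|exact: gD].
Qed.

Lemma tangentM i j f f' g g' : i != j ->
  tangent i j f f' -> tangent i j g g' ->
  tangent i j (fun x => f x * g x) (fun x => f' x * g x + f x * g' x).
Proof.
move=> ij [tf tf' [C fC]] [tg tg' [D gD]]; split.
- exact: tameM.
- by apply: tameD; exact: tameM.
have [[_ [M fM]] [_ [M' fM']]] := (tf, tf').
have [[_ [N gN]] [_ [N' gN']]] := (tg, tg').
exists (C * N + (M + 2 * M') * D + 4 * (M' * N')) => u x u1 Sx.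
set Rx := givens n i j u x.
have SRx : unit_sphere n Rx by exact: unit_sphere_givens.
(* With f Rx = f + 2 u f' + a and g Rx = g + 2 u g' + b, the product f Rx * g Rx
   differs from its linear part by a * g Rx + (f + 2 u f') b + 4 u^2 f' g'. *)
rewrite (_ : _ - _ - _ = (f Rx - f x - 2 * u * f' x) * g Rx +
  (f x + 2 * u * f' x) * (g Rx - g x - 2 * u * g' x) +
  4 * u ^+ 2 * (f' x * g' x)); last by ring.
rewrite [leRHS]mulrDl; apply: le_trans (ler_normD _ _) _; apply: lerD.
  rewrite [leRHS]mulrDl.
  apply: le_trans (ler_normD _ _) _; apply: lerD; rewrite normrM.
    by rewrite [leRHS]mulrAC; apply: ler_pM => //; [exact: fC|exact: gN].
  rewrite -[leRHS]mulrA; apply: ler_pM => //; last exact: gD.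
  apply: le_trans (ler_normD _ _) _; apply: lerD; first exact: fM.
  rewrite -mulrA normrM ger0_norm//; apply: ler_wpM2l => //.
  by rewrite normrM -[leRHS]mul1r; apply: ler_pM => //; exact: fM'.
rewrite normrM ger0_norm; last by rewrite mulr_ge0 ?sqr_ge0.
rewrite (_ : 4 * (M' * N') * u ^+ 2 = 4 * u ^+ 2 * (M' * N')); last by ring.
apply: ler_wpM2l; first by rewrite mulr_ge0 ?sqr_ge0.
by rewrite normrM; apply: ler_pM => //; [exact: fM'|exact: gN'].
Qed.

Lemma tangentX i j f f' m : i != j -> tangent i j f f' ->
  tangent i j (fun x => f x ^+ m) (fun x => m%:R * f x ^+ m.-1 * f' x).
Proof.
move=> ij tf; elim: m => [|m IHm].
  rewrite (_ : (fun x => _ * _ * _) = fun=> 0); first exact: tangent_cst.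
  by apply/funext => x; rewrite !mul0r.
have := tangentM i j f f' _ _ ij tf IHm.
congr tangent; apply/funext => x; first by rewrite exprS.
by case: m {IHm} => [|m]; rewrite /= ?exprS; ring.
Qed.

Lemma tangent_sum i j (I : Type) (r : seq I) (F F' : I -> n.-tuple R -> R) :
  (forall a, tangent i j (F a) (F' a)) ->
  tangent i j (fun x => \sum_(a <- r) F a x) (fun x => \sum_(a <- r) F' a x).
Proof.
move=> tF; elim: r => [|a r IHr].
  have := tangent_cst i j 0.
  by congr tangent; apply/funext => x; rewrite big_nil.
have := tangentD _ _ _ _ _ _ (tF a) IHr.
by congr tangent; apply/funext => x; rewrite big_cons.
Qed.

Lemma givens_cos_approx (u : R) : `|givens_cos u - 1| <= 2 * u ^+ 2.
Proof.
have u0 := sqr1D_neq0 u.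
rewrite (_ : _ - 1 = - (2 * u ^+ 2 / (1 + u ^+ 2))); last first.
  by rewrite /givens_cos; field.
have u2 := sqr_ge0 u.
rewrite normrN ger0_norm; last by apply: divr_ge0; lra.
rewrite ler_pdivrMr; last by lra.
by apply: ler_peMr; lra.
Qed.

Lemma givens_sin_approx (u : R) : `|u| <= 1 ->
  `|givens_sin u - 2 * u| <= 2 * u ^+ 2.
Proof.
move=> u1; have u0 := sqr1D_neq0 u.
rewrite (_ : _ - _ = u * - (2 * u ^+ 2 / (1 + u ^+ 2))); last first.
  by rewrite /givens_sin; field.
rewrite normrM -[leRHS]mul1r; apply: ler_pM => //.
have u2 := sqr_ge0 u.
rewrite normrN ger0_norm; last by apply: divr_ge0; lra.
rewrite ler_pdivrMr; last by lra.
by apply: ler_peMr; lra.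
Qed.

Definition givens_deriv i j k (x : n.-tuple R) : R :=
  if k == i then - tnth x j else if k == j then tnth x i else 0.

Lemma tangent_tnth i j k : i != j ->
  tangent i j (fun x => tnth x k) (givens_deriv i j k).
Proof.
move=> ij; have ji : j != i by rewrite eq_sym.
split; first exact: tame_tnth.
  rewrite /givens_deriv; have [_|_] := eqVneq k i; last first.
    by have [_|_] := eqVneq k j; [exact: tame_tnth|exact: tame_cst].
  rewrite (_ : (fun x => _) = fun x => -1 * tnth x j).
    by apply: tameM; [exact: tame_cst|exact: tame_tnth].
  by apply/funext => x; rewrite mulN1r.
exists 4 => u x u1 Sx; rewrite tnth_mktuple /givens_deriv.
have small (a b s t : R) : `|s| <= 1 -> `|t| <= 1 -> `|a| <= 2 * u ^+ 2 ->
    `|b| <= 2 * u ^+ 2 -> `|a * s + b * t| <= 4 * u ^+ 2.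
  move=> s1 t1 ha hb; apply: le_trans (ler_normD _ _) _.
  rewrite (_ : 4 * u ^+ 2 = 2 * u ^+ 2 * 1 + 2 * u ^+ 2 * 1); last by ring.
  by rewrite !normrM; apply: lerD; apply: ler_pM.
have [xi xj] := (norm_tnth_le1 n x i Sx, norm_tnth_le1 n x j Sx).
have [ci si] := (givens_cos_approx u, givens_sin_approx u u1).
have [->|ki] := eqVneq k i.
  rewrite (_ : _ - _ - _ = (givens_cos u - 1) * tnth x i +
    (- (givens_sin u - 2 * u)) * tnth x j); last by ring.
  by apply: small => //; rewrite normrN.
have [->|kj] := eqVneq k j.
  rewrite (_ : _ - _ - _ = (givens_sin u - 2 * u) * tnth x i +
    (givens_cos u - 1) * tnth x j); last by ring.
  exact: small.
by rewrite subrr mulr0 subrr normr0 mulr_ge0 ?sqr_ge0.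
Qed.

Definition dotp (x z : n.-tuple R) : R := \sum_k tnth x k * tnth z k.

Lemma tame_dotp x : tame n (dotp x).
Proof.
apply: tame_sum => k; apply: tameM; [exact: tame_cst|exact: tame_tnth].
Qed.

Lemma tangent_dotp i j (x : n.-tuple R) : i != j -> tangent i j (dotp x)
  (fun z => tnth x j * tnth z i - tnth x i * tnth z j).
Proof.
move=> ij; have ji : j != i by rewrite eq_sym.
have := tangent_sum i j _ (index_enum 'I_n) _ _ (fun k =>
  tangentM i j _ _ _ _ ij (tangent_cst i j (tnth x k)) (tangent_tnth i j k ij)).
congr tangent; apply/funext => z.
rewrite (bigD1 i)//= (bigD1 j)//= big1 ?addr0 => [|k /andP[ki kj]].
  by rewrite /givens_deriv !eqxx (negbTE ji); ring.
by rewrite /givens_deriv (negbTE ki) (negbTE kj); ring.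
Qed.

Lemma tame_givens i j u f : i != j -> tame n f -> tame n (f \o givens n i j u).
Proof.
move=> ij [mf [M fM]]; have [mg _] := preserving_givens n i j u ij.
split; first exact: measurableT_comp.
by exists M => x Sx; apply: fM; exact: unit_sphere_givens.
Qed.

(** The integrals of f and of its rotate agree, so integrating the estimate
gives 2 u * sphere_int n f' <= C u^2 for all small u > 0. *)
Lemma sphere_int_tangent_le0 i j f f' : i != j -> tangent i j f f' ->
  sphere_int n f' <= 0.
Proof.
move=> ij [tf tf' [C fC]]; rewrite leNgt; apply/negP => e0.
set e := sphere_int n f' in e0.
have C0 := normr_ge0 C.
have eC : 0 < e + `|C| by rewrite ltr_pwDl.
(* For this u the bound 2 e <= `|C| * u would give 2 e < e. *)
have [u [u0 u1 uE]] : exists u, [/\ 0 < u, u <= 1 & u * (e + `|C|) = e].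
  exists (e / (e + `|C|)); split; first by rewrite divr_gt0.
    by rewrite ler_pdivrMr// mul1r lerDl.
  by rewrite divfK// gt_eqF.
have tfg := tame_givens i j u f ij tf.
have : sphere_int n (fun x => 2 * u * f' x) <=
       sphere_int n (fun x => f (givens n i j u x) + (-1 * f x + C * u ^+ 2)).
  apply: le_sphere_int => //.
  - by apply: tameM => //; exact: tame_cst.
  - apply: tameD => //; apply: tameD; last exact: tame_cst.
    by apply: tameM => //; exact: tame_cst.
  - move=> x Sx; have := fC u x; rewrite (ger0_norm (ltW u0)) => /(_ u1 Sx).
    by rewrite ler_norml => /andP[h _]; lra.
rewrite (sphere_intZ _ n_gt0 (2 * u))//.
rewrite (sphere_intD _ n_gt0 (f \o givens n i j u))//; last first.
  apply: tameD; last exact: tame_cst.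
  by apply: tameM => //; exact: tame_cst.
rewrite sphere_int_givens// sphere_intD//; last 2 first.
- by apply: tameM => //; exact: tame_cst.
- exact: tame_cst.
rewrite (sphere_intZ _ n_gt0 (-1))// sphere_int_cst// -/e => h.
have : 2 * u * e <= `|C| * u * u.
  apply: (@le_trans _ _ (C * u ^+ 2)); first by lra.
  by rewrite -mulrA -expr2 ler_wpM2r ?sqr_ge0 ?ler_norm.
rewrite -mulrA mulrCA [_ * u]mulrC ler_pM2l// => h2.
have := mulr_gt0 u0 e0; nra.
Qed.

(** The previous bound applies to f and to - f. *)
Lemma sphere_int_tangent i j f f' : i != j -> tangent i j f f' ->
  sphere_int n f' = 0.
Proof.
move=> ij tf; apply/eqP; rewrite eq_le (sphere_int_tangent_le0 i j f)//=.
have := tangentM i j _ _ _ _ ij (tangent_cst i j (-1)) tf.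
rewrite (_ : (fun x => 0 * _ + _) = fun x => -1 * f' x); last first.
  by apply/funext => x; rewrite mul0r add0r.
move/(sphere_int_tangent_le0 _ _ _ _ ij).
rewrite sphere_intZ// ?mulN1r ?oppr_le0//.
by case: tf.
Qed.

End infinitesimal_rotations.

(** * Integration by parts and the recursion for the moments *)

Section moments.
Context {R : realType} (n : nat) (n_gt0 : (0 < n)%N).
Implicit Types (x y z : n.-tuple R) (a b : nat).

Definition moment a b x y : R :=
  sphere_int n (fun z => dotp n x z ^+ a * dotp n y z ^+ b).

Lemma unit_sphere_sum z : unit_sphere n z -> \sum_i tnth z i ^+ 2 = 1 :> R.
Proof.
move=> Sz; rewrite -[RHS](expr1n _ 2) -[in RHS]Sz sqr_sqrtr//.
by apply: sumr_ge0 => i _; exact: sqr_ge0.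
Qed.

Lemma dotp_diag z : unit_sphere n z -> dotp n z z = 1.
Proof. by move=> /unit_sphere_sum <-; apply: eq_bigr => i _; rewrite expr2. Qed.

Lemma tame_dotpX a b x y : tame n (fun z => dotp n x z ^+ a * dotp n y z ^+ b).
Proof. by apply: tameM; apply: tameX; exact: tame_dotp. Qed.

(** Integration by parts on the sphere, for r = <x, z>^a <y, z>^b: it reads
(n - 1 + deg r) * int z_j r = int (d r / d z_j).  For each i the derivative of
z_i r along the rotation in the plane of i and j has integral 0; the sum over i
of these identities, by z_1^2 + ... + z_n^2 = 1 and by Euler's identity for the
homogeneous function r, is the claim. *)
Lemma sphere_int_by_parts j a b x y :
  (n%:R - 1 + a%:R + b%:R) *
    sphere_int n (fun z => tnth z j * (dotp n x z ^+ a * dotp n y z ^+ b)) =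
  a%:R * tnth x j * moment a.-1 b x y + b%:R * tnth y j * moment a b.-1 x y.
Proof.
pose zr z := tnth z j * (dotp n x z ^+ a * dotp n y z ^+ b).
pose ra z := dotp n x z ^+ a.-1 * dotp n y z ^+ b.
pose rb z := dotp n x z ^+ a * dotp n y z ^+ b.-1.
have tr : tame n zr by apply: tameM; [exact: tame_tnth|exact: tame_dotpX].
have tra : tame n ra by exact: tame_dotpX.
have trb : tame n rb by exact: tame_dotpX.
pose D x i z := tnth x j * tnth z i ^+ 2 - tnth x i * tnth z i * tnth z j.
(* For i <> j this is the derivative of z_i r; for i = j it is - z_j r, which
   makes the sum over all i easy to compute. *)
pose T i z := -1 * zr z + (a%:R * (ra z * D x i z) + b%:R * (rb z * D y i z)).
have tD w i : tame n (D w i).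
  rewrite /D (_ : (fun _ => _) = fun z => tnth w j * tnth z i ^+ 2 +
      (- tnth w i) * (tnth z i * tnth z j)); last by apply/funext => z; ring.
  by apply: tameD; apply: tameM; try exact: tame_cst;
    [apply: tameX|apply: tameM]; exact: tame_tnth.
have tT i : tame n (T i).
  apply: tameD; first by apply: tameM => //; exact: tame_cst.
  by apply: tameD; apply: tameM; try exact: tame_cst; exact: tameM.
have T0 i : i != j -> sphere_int n (T i) = 0.
  move=> ij; apply: (sphere_int_tangent n n_gt0 i j (fun z => tnth z i *
    (dotp n x z ^+ a * dotp n y z ^+ b))) => //.
  have := tangentM n i j _ _ _ _ ij (tangent_tnth n i j i ij)
    (tangentM n i j _ _ _ _ ij
      (tangentX n i j _ _ a ij (tangent_dotp n i j x ij))
      (tangentX n i j _ _ b ij (tangent_dotp n i j y ij))).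
  congr tangent; apply/funext => z.
  by rewrite /T /zr /ra /rb /D /givens_deriv eqxx; ring.
have : \sum_i sphere_int n (T i) = - sphere_int n zr.
  rewrite (bigD1 j)//= big1 ?addr0 => [|i /T0//].
  rewrite -mulN1r -sphere_intZ//; apply: eq_sphere_int => z _.
  by rewrite /T /D; ring.
rewrite -sphere_int_sum//.
have -> : sphere_int n (fun z => \sum_i T i z) =
  sphere_int n (fun z => - (n%:R + a%:R + b%:R) * zr z +
    (a%:R * tnth x j * ra z + b%:R * tnth y j * rb z)).
  apply: eq_sphere_int => z Sz; rewrite /T !big_split/=.
  have DE w (c q : R) : \sum_i c * (q * D w i z) =
      c * (q * (tnth w j - dotp n w z * tnth z j)).
    rewrite -2!mulr_sumr /D sumrB -mulr_sumr unit_sphere_sum// mulr1.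
    by rewrite /dotp mulr_suml.
  rewrite !DE sumr_const card_ord -[X in X + _]mulr_natl.
  rewrite (_ : a%:R * (ra z * (tnth x j - dotp n x z * tnth z j)) =
      a%:R * tnth x j * ra z - a%:R * zr z); last first.
    by rewrite /ra /zr; case: (a) => [|m]; rewrite /= ?exprS; ring.
  rewrite (_ : b%:R * (rb z * (tnth y j - dotp n y z * tnth z j)) =
      b%:R * tnth y j * rb z - b%:R * zr z); last first.
    by rewrite /rb /zr; case: (b) => [|m]; rewrite /= ?exprS; ring.
  ring.
rewrite sphere_intD//; last 2 first.
- by apply: tameM => //; exact: tame_cst.
- by apply: tameD; apply: tameM => //; exact: tame_cst.
rewrite (sphere_intZ _ n_gt0 (- _))// sphere_intD//; last 2 first.
- by apply: tameM => //; exact: tame_cst.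
- by apply: tameM => //; exact: tame_cst.
rewrite (sphere_intZ _ n_gt0 _ ra)// (sphere_intZ _ n_gt0 _ rb)//.
rewrite -/(moment _ _ _ _) -[sphere_int n rb]/(moment a b.-1 x y) => h.
by apply/eqP; rewrite -subr_eq0; apply/eqP; rewrite -/zr; lra.
Qed.

(** The combination of the integrations by parts for all j, with weights x_j. *)
Lemma moment_rec a b x y : unit_sphere n x ->
  (n%:R - 1 + a%:R + b%:R) * moment a.+1 b x y =
  a%:R * moment a.-1 b x y + b%:R * dotp n x y * moment a b.-1 x y.
Proof.
move=> Sx; transitivity (\sum_j tnth x j * ((n%:R - 1 + a%:R + b%:R) *
    sphere_int n (fun z => tnth z j * (dotp n x z ^+ a * dotp n y z ^+ b)))).
  have tj j : tame n (fun z => tnth z j * (dotp n x z ^+ a * dotp n y z ^+ b)).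
    by apply: tameM; [exact: tame_tnth|exact: tame_dotpX].
  rewrite -[in RHS](eq_bigr _ (fun j _ => mulrCA _ _ _)) -mulr_sumr.
  congr (_ * _).
  under eq_bigr => j _ do rewrite -sphere_intZ//.
  rewrite -sphere_int_sum//; last first.
    by move=> j; apply: tameM => //; exact: tame_cst.
  apply: eq_sphere_int => z _; rewrite exprS -!mulrA {1}/dotp mulr_suml.
  by apply: eq_bigr => j _; rewrite -[LHS]mulrA.
under eq_bigr => j _ do rewrite sphere_int_by_parts mulrDr.
rewrite big_split/=; congr (_ + _).
  rewrite -[RHS]mul1r -(dotp_diag x Sx) /dotp mulr_suml.
  by apply: eq_bigr => j _; ring.
rewrite /dotp mulr_sumr mulr_suml.
by apply: eq_bigr => j _; ring.
Qed.

End moments.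

(** * The moments as polynomials in the inner product *)

Section moment_expansion.
Context {R : realType} (n : nat) (n_gt0 : (0 < n)%N).
Implicit Types (x y : n.-tuple R) (a b k : nat).

(** The integral of <x, z>^(2k) over the sphere, for a unit vector x, that is
1 * 3 * ... * (2k - 1) / (n (n + 2) ... (n + 2k - 2)). *)
Fixpoint even_moment k : R :=
  if k is k'.+1 then (2 * k' + 1)%:R / (n + 2 * k')%:R * even_moment k' else 1.

Lemma even_moment_ge0 k : 0 <= even_moment k.
Proof. by elim: k => //= k IHk; rewrite !mulr_ge0 ?invr_ge0. Qed.

Lemma moment_sym a b x y : moment n a b x y = moment n b a y x.
Proof. by apply: eq_sphere_int => z _; rewrite mulrC. Qed.

Lemma moment_even k x y : unit_sphere n x ->
  moment n (2 * k) 0 x y = even_moment k.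
Proof.
move=> Sx; elim: k => [|k IHk] /=.
  rewrite -[RHS](sphere_int_cst n n_gt0).
  by apply: eq_sphere_int => z _; rewrite !expr0 mulr1.
have := moment_rec n n_gt0 (2 * k).+1 0 x y Sx.
rewrite mul0r mul0r addr0 addr0 IHk.
rewrite (_ : (2 * k.+1 = (2 * k).+2)%N); last by lia.
have nk : (n + 2 * k)%:R != 0 :> R by rewrite pnatr_eq0; lia.
rewrite (_ : n%:R - 1 + _ = (n + 2 * k)%:R); last by rewrite natrD -natr1; ring.
by move=> h; apply: (mulfI nk); rewrite h addn1 mulrA mulrCA divff// mulr1.
Qed.

(** A bound for all coefficients of moments of total exponent 2k: only the
power of n in it has to be sharp. *)
Definition coef_bound k : R := (2 * k)`!%:R / n%:R ^+ k.

Let n0 : 0 < n%:R :> R.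
Proof. by rewrite ltr0n. Qed.

(** The step from k to k + 1 in the recursion of the moments adds at most
2k + 1 terms of the previous size and divides by at least n. *)
Lemma coef_boundS k c : 0 <= c -> c <= (2 * k).+1%:R * coef_bound k ->
  c / n%:R <= coef_bound k.+1.
Proof.
move=> c0 cB; rewrite /coef_bound exprS invfM [leRHS]mulrA [leRHS]mulrAC.
rewrite ler_pM2r ?invr_gt0//.
apply: le_trans cB _.
rewrite /coef_bound mulrA ler_wpM2r ?invr_ge0 ?exprn_ge0//.
rewrite -natrM ler_nat (_ : (2 * k.+1 = (2 * k).+2)%N); last by lia.
by rewrite factS leq_pmull// factS.
Qed.

Lemma even_moment_le k : even_moment k <= coef_bound k.
Proof.
elim: k => [|k IHk] /=; first by rewrite /coef_bound expr0 divr1.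
apply: le_trans (_ : (2 * k).+1%:R * even_moment k / n%:R <= _).
  rewrite mulrAC addn1 mulrAC -mulrA -[leRHS]mulrA ler_wpM2l//.
  rewrite mulrC ler_wpM2l ?even_moment_ge0//.
  rewrite lef_pV2 ?posrE ?ltr0n ?addn_gt0 ?n_gt0//.
  by rewrite ler_nat leq_addr.
by apply: coef_boundS; rewrite ?mulr_ge0 ?even_moment_ge0// ler_wpM2l.
Qed.

Lemma coef_bound_ge0 k : 0 <= coef_bound k.
Proof. by rewrite divr_ge0 ?exprn_ge0. Qed.

(** Everything is read off the recursion [moment_rec], which expresses the
moment of exponents a + 1 and b by those of a - 1 and b and of a and b - 1, the
latter times <x, y>.  The constant coefficient comes only from the first of
these, with factor a / (n - 1 + a + b); the recursion for [even_moment] has the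
larger factor a / (n - 1 + a), hence the fourth property. *)
Lemma moment_expansion k a b : (a + b = 2 * k)%N -> exists e : {poly R},
  [/\ (size e <= a.+1)%N,
      forall j, 0 <= e`_j <= coef_bound k,
      forall j, odd (a + j) -> e`_j = 0,
      forall p q, a = (2 * p)%N -> b = (2 * q)%N ->
        e`_0 <= even_moment p * even_moment q
    & forall x y, unit_sphere n x -> unit_sphere n y ->
        moment n a b x y = e.[dotp n x y]].
Proof.
elim: k a b => [|k IHk] a b abk.
  have [-> ->] : a = 0 /\ b = 0 by lia.
  exists 1; split.
  - by rewrite size_poly1.
  - move=> j; rewrite coef1 /coef_bound muln0 fact0 expr0 divr1.
    by case: j => [|j] /=; rewrite lexx ler01.
  - by move=> [|j]// _; rewrite coef1.
  - by move=> [|p] [|q]//; rewrite coef1 mulr1.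
  - by move=> x y Sx Sy; rewrite (moment_even 0)// hornerC.
case: a abk => [|a] abk.
  exists (even_moment k.+1)%:P; split.
  - exact: size_polyC_leq1.
  - move=> j; rewrite coefC; case: ifP => _.
      by rewrite even_moment_ge0 even_moment_le.
    by rewrite lexx coef_bound_ge0.
  - by move=> [|j]// _; rewrite coefC.
  - move=> [|p] q// _ bq; rewrite coefC mul1r (_ : q = k.+1)//; lia.
  - move=> x y Sx Sy; rewrite moment_sym (_ : b = (2 * k.+1)%N); last by lia.
    by rewrite moment_even// hornerC.
(* For a = 0 the first term of the recursion vanishes, and a.-1 is not the
   exponent a - 1; the zero polynomial will do.  The same holds for b = 0
   below. *)
have [e1 [s1 B1 o1 c1 E1]] : exists e : {poly R},
  [/\ (size e <= a.+1)%N,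
      forall j, 0 <= e`_j <= coef_bound k,
      forall j, odd (a.+1 + j) -> e`_j = 0,
      forall p q, a.+1 = (2 * p.+1)%N -> b = (2 * q)%N ->
        e`_0 <= even_moment p * even_moment q
    & forall x y, unit_sphere n x -> unit_sphere n y ->
        a%:R * moment n a.-1 b x y = a%:R * e.[dotp n x y]].
  case: a abk => [|a] abk; last first.
    have [|e [s B o c E]] := IHk a b; first by lia.
    exists e; split => //.
    - by apply: leq_trans s _.
    - by move=> j oj; apply: o; move: oj => /=; rewrite negbK.
    - by move=> p q ap bq; apply: c => //; lia.
    - by move=> x y Sx Sy; rewrite E.
  exists 0; split.
  - by rewrite size_poly0.
  - by move=> j; rewrite coef0 lexx coef_bound_ge0.
  - by move=> j _; rewrite coef0.
  - by move=> p q; lia.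
  - by move=> x y _ _; rewrite !mul0r.
have [e2 [s2 B2 o2 E2]] : exists e : {poly R},
  [/\ (size e <= a.+1)%N,
      forall j, 0 <= e`_j <= coef_bound k,
      forall j, odd (a + j) -> e`_j = 0
    & forall x y, unit_sphere n x -> unit_sphere n y ->
        b%:R * moment n a b.-1 x y = b%:R * e.[dotp n x y]].
  case: b abk {e1 s1 B1 o1 c1 E1} => [|b] abk; last first.
    have [|e [s B o c E]] := IHk a b; first by lia.
    by exists e; split => // x y Sx Sy; rewrite E.
  exists 0; split.
  - by rewrite size_poly0.
  - by move=> j; rewrite coef0 lexx coef_bound_ge0.
  - by move=> j _; rewrite coef0.
  - by move=> x y _ _; rewrite !mul0r.
pose D : R := (n + (2 * k))%:R.
have D0 : 0 < D by rewrite ltr0n addn_gt0 n_gt0.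
have DE : n%:R - 1 + a%:R + b%:R = D.
  apply: (addIr 1); rewrite /D natr1 -addnS.
  rewrite (_ : n + _ = n + (a + b))%N; last by lia.
  by rewrite !natrD; ring.
exists (D^-1 *: (a%:R *: e1 + b%:R *: (e2 * 'X))).
have cE j : (D^-1 *: (a%:R *: e1 + b%:R *: (e2 * 'X)))`_j =
    (a%:R * e1`_j + b%:R * (if j is j'.+1 then e2`_j' else 0)) / D.
  by rewrite coefZ coefD !coefZ coefMX mulrC; case: j.
have B2' j : 0 <= (if j is j'.+1 then e2`_j' else 0) <= coef_bound k.
  by case: j => [|j]; rewrite ?B2// lexx coef_bound_ge0.
split.
- apply: leq_trans (size_scale_leq _ _) _.
  apply: leq_trans (size_polyD _ _) _; rewrite geq_max.
  rewrite (leq_trans (size_scale_leq _ _) (leqW s1))/=.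
  apply: leq_trans (size_scale_leq _ _) _.
  by apply: leq_trans (size_polyMleq _ _) _; rewrite size_polyX addn2.
- move=> j; rewrite cE; have /andP[l1 u1] := B1 j; have /andP[l2 u2] := B2' j.
  have c0 : 0 <= a%:R * e1`_j + b%:R * (if j is j'.+1 then e2`_j' else 0).
    by rewrite addr_ge0 ?mulr_ge0.
  rewrite divr_ge0 ?(ltW D0)//=.
  apply: le_trans (_ : _ / n%:R <= _).
    by apply: ler_wpM2l => //; rewrite lef_pV2 ?posrE// ler_nat leq_addr.
  apply: coef_boundS => //.
  rewrite (_ : (2 * k).+1 = (a + b)%N); last by lia.
  by rewrite natrD mulrDl; apply: lerD; apply: ler_wpM2l.
- move=> j oj; rewrite cE o1// mulr0 add0r.
  case: j oj => [|j] oj; first by rewrite mulr0 mul0r.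
  by rewrite o2 ?mulr0 ?mul0r//; move: oj; rewrite addnS /= negbK.
- move=> [|p] q ap bq; first by lia.
  rewrite cE mulr0 addr0 /= (_ : a = (2 * p + 1)%N); last by lia.
  rewrite mulrAC -[leRHS]mulrA; apply: ler_pM.
  + by rewrite divr_ge0// ltW.
  + by have /andP[] := B1 0%N.
  + rewrite ler_wpM2l// lef_pV2 ?posrE// ?ltr0n ?addn_gt0 ?n_gt0//.
    by rewrite ler_nat; lia.
  + exact: c1.
- move=> x y Sx Sy; rewrite !(hornerE, hornerZ, hornerD, hornerMX).
  have := moment_rec n n_gt0 a b x y Sx.
  rewrite DE E1// [b%:R * _ * _]mulrAC E2// => h.
  apply: (mulfI (lt0r_neq0 D0)); rewrite h mulrA divff ?(lt0r_neq0 D0)// mul1r.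
  by [].
Qed.

End moment_expansion.

(** * Sums of powers of inner products over a finite set *)

Section power_sums.
Context {R : realType} (n : nat) (n_gt0 : (0 < n)%N) (X : seq (n.-tuple R)).
Implicit Types (c : n.-tuple R -> R) (k : nat).

(** The weights c are what makes induction on k possible: since <x, y> is the
sum of x_i y_i over i, a factor <x, y> can be moved into the weights
([power_sumS]). *)
Definition power_sum k c : R :=
  \sum_(x <- X) \sum_(y <- X) c x * c y * dotp n x y ^+ k.

Lemma power_sum0 c : power_sum 0 c = (\sum_(x <- X) c x) ^+ 2.
Proof.
rewrite expr2 mulr_suml; apply: eq_bigr => x _; rewrite mulr_sumr.
by apply: eq_bigr => y _; rewrite expr0 mulr1.
Qed.

Lemma power_sumS k c :
  power_sum k.+1 c = \sum_i power_sum k (fun x => c x * tnth x i).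
Proof.
rewrite exchange_big/=; apply: eq_bigr => x _.
rewrite exchange_big/=; apply: eq_bigr => y _.
rewrite exprS /dotp mulr_suml mulr_sumr.
by apply: eq_bigr => i _; ring.
Qed.

Lemma power_sum_ge0 k c : 0 <= power_sum k c.
Proof.
elim: k c => [|k IHk] c; first by rewrite power_sum0 sqr_ge0.
by rewrite power_sumS; apply: sumr_ge0.
Qed.

Lemma sqr_sum_le (u : 'I_n -> R) : (\sum_i u i) ^+ 2 <= n%:R * \sum_i u i ^+ 2.
Proof.
have n0 : 0 < n%:R :> R by rewrite ltr0n.
set s := \sum_i u i.
have : 0 <= \sum_i (n%:R * u i - s) ^+ 2.
  by apply: sumr_ge0 => i _; exact: sqr_ge0.
rewrite (eq_bigr (fun i => n%:R ^+ 2 * u i ^+ 2 +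
  (- (2 * n%:R * s) * u i + s ^+ 2))); last by move=> i _; ring.
rewrite !big_split/= -!mulr_sumr -/s sumr_const card_ord -[s *+ n]mulr_natl.
rewrite (_ : _ + _ = n%:R * (n%:R * (\sum_i u i ^+ 2) - s ^+ 2)); last by ring.
by rewrite pmulr_rge0// subr_ge0.
Qed.

Hypothesis X_sphere : forall x, x \in X -> unit_sphere n x.

(** For k = 0, let T_ij be the sum of c(x) x_i x_j over X.  The left-hand side
is the square of the trace of T, as the points are unit vectors, and the sum on
the right is the sum of all T_ij^2, so this is the inequality of Cauchy and
Schwarz on the diagonal. *)
Lemma power_sum_leSS k c : power_sum k c <= n%:R * power_sum k.+2 c.
Proof.
elim: k c => [|k IHk] c; last first.
  by rewrite !power_sumS mulr_sumr; apply: ler_sum => i _.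
rewrite power_sum0 (_ : \sum_(x <- X) c x =
    \sum_i \sum_(x <- X) c x * tnth x i * tnth x i); last first.
  rewrite exchange_big/=; apply: eq_big_seq => x /X_sphere Sx.
  rewrite -[LHS]mulr1 -(dotp_diag n x Sx) mulr_sumr.
  by apply: eq_bigr => i _; rewrite mulrA.
apply: le_trans (sqr_sum_le _) _.
apply: ler_wpM2l => //; rewrite power_sumS; apply: ler_sum => i _.
rewrite power_sumS (bigD1 i)//= power_sum0 lerDl.
by apply: sumr_ge0 => j _; exact: power_sum_ge0.
Qed.

Lemma power_sum_le_top t i c : (1 <= i <= t)%N ->
  power_sum (2 * i) c <= n%:R ^+ (t - 1) * power_sum (2 * t) c.
Proof.
move=> /andP[i1 it]; have n1 : 1 <= n%:R :> R by rewrite ler1n.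
have h m : power_sum (2 * i) c <= n%:R ^+ m * power_sum (2 * (i + m)) c.
  elim: m => [|m IHm]; first by rewrite addn0 mul1r.
  apply: le_trans IHm _; rewrite exprSr -mulrA; apply: ler_wpM2l => //.
  rewrite addnS (_ : (2 * (i + m).+1 = (2 * (i + m)).+2)%N); last by lia.
  exact: power_sum_leSS.
apply: le_trans (h (t - i)%N) _; rewrite subnKC//.
apply: ler_wpM2r; first exact: power_sum_ge0.
by apply: ler_weXn2l => //; lia.
Qed.

End power_sums.

(** * Degrees of polynomials *)

Section degree.
Context {R : realType} (n : nat).
Implicit Types p q : mpoly n R.

Lemma degree_leM s t p q : degree_le s p -> degree_le t q ->
  degree_le (s + t) (p * q).
Proof.
rewrite /degree_le => ps qt.
have [->|p0] := eqVneq p 0; first by rewrite mul0r msize0.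
have [->|q0] := eqVneq q 0; first by rewrite mulr0 msize0.
rewrite msizeM// -subn1 leq_subLR.
by apply: leq_trans (leq_add ps qt) _; rewrite addSn addnS add1n.
Qed.

Lemma degree_leX k p : degree_le 1 p -> degree_le k (p ^+ k).
Proof.
move=> p1; elim: k => [|k IHk]; first by rewrite expr0 /degree_le msize1.
by rewrite exprS -add1n; exact: degree_leM.
Qed.

Lemma degree_leZ s c p : degree_le s p -> degree_le s (c *: p).
Proof. by apply: leq_trans; exact: msizeZ_le. Qed.

Lemma degree_leB s p q : degree_le s p -> degree_le s q -> degree_le s (p - q).
Proof.
move=> ps qs; apply: leq_trans (msizeD_le _ _) _.
by rewrite msizeN geq_max; apply/andP.
Qed.

Lemma degree_leC s c : degree_le s (mpolyC n c : mpoly n R).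
Proof. by rewrite /degree_le mmeasureC; case: (c != 0). Qed.

Lemma degree_le_sum s (I : Type) (r : seq I) (F : I -> mpoly n R) :
  (forall i, degree_le s (F i)) -> degree_le s (\sum_(i <- r) F i).
Proof.
move=> Fs; apply: leq_trans (msize_sum _ _ _) _.
elim: r => [|i r IHr]; rewrite ?big_nil// big_cons geq_max IHr andbT.
exact: Fs.
Qed.

Definition dotp_poly (x : n.-tuple R) : mpoly n R :=
  \sum_k tnth x k *: mpolyX R (mnm1 k).

Lemma meval_dotp_poly x z : meval (tnth z) (dotp_poly x) = dotp n x z.
Proof.
rewrite /dotp_poly raddf_sum; apply: eq_bigr => k _.
by rewrite /= mevalZ mevalXU.
Qed.

Lemma degree_le_dotp_poly x : degree_le 1 (dotp_poly x).
Proof.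
apply: degree_le_sum => k; apply: degree_leZ.
by rewrite /degree_le msizeX mdeg1.
Qed.

End degree.

(** * The mean square of the averaged kernel *)

Section averaged_kernel.
Context {R : realType} (n : nat) (n_gt0 : (0 < n)%N) (X : seq (n.-tuple R)).
Hypothesis X_sphere : forall x, x \in X -> unit_sphere n x.
Variable t : nat.

Let S k := power_sum n X k (fun=> 1).

(** After expansion of the moment in powers of <x, y>, the constant term gives
the first summand; each of the other 2t terms is 0 if its exponent is odd, and
is compared with the top power if it is even. *)
Lemma sum_moment_le :
  \sum_(x <- X) \sum_(y <- X) moment n (2 * t) (2 * t) x y <=
  (size X)%:R ^+ 2 * even_moment n t ^+ 2 +
  (2 * t)%:R * (coef_bound n (2 * t) * n%:R ^+ (t - 1)) * S (2 * t).
Proof.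
have tt : (2 * t + 2 * t = 2 * (2 * t))%N by lia.
have [e [se Be oe ce E]] := @moment_expansion R n n_gt0 _ _ _ tt.
have -> : \sum_(x <- X) \sum_(y <- X) moment n (2 * t) (2 * t) x y =
    \sum_(j < (2 * t).+1) e`_j * S j.
  under [RHS]eq_bigr => j _ do rewrite mulr_sumr.
  rewrite [RHS]exchange_big/=; apply: eq_big_seq => x /X_sphere Sx.
  under [RHS]eq_bigr => j _ do rewrite mulr_sumr.
  rewrite [RHS]exchange_big/=; apply: eq_big_seq => y /X_sphere Sy.
  rewrite E// (horner_coef_wide _ se); apply: eq_bigr => j _.
  by rewrite !mul1r.
rewrite big_ord_recl; apply: lerD.
  rewrite mulrC /S power_sum0 -[in leRHS]sum1_size natr_sum.
  rewrite ler_wpM2l ?sqr_ge0//.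
  by rewrite expr2; exact: ce.
set B := coef_bound _ _ * _.
have B0 : 0 <= B * S (2 * t).
  by rewrite !mulr_ge0 ?coef_bound_ge0 ?exprn_ge0 ?power_sum_ge0.
rewrite -mulrA [leRHS]mulr_natl -[X in _ *+ X](card_ord (2 * t)) -sumr_const.
apply: ler_sum => j _; rewrite /=.
have [oj|ej] := boolP (odd (bump 0 j)).
  by rewrite oe ?mul0r// oddD oj mul2n odd_double.
have /andP[e0 eB] := Be (bump 0 j).
rewrite /B -mulrA; apply: ler_pM => //; first exact: power_sum_ge0.
have evenE m : ~~ odd m -> m = (2 * m./2)%N.
  by move=> em; rewrite mul2n -[LHS]odd_double_half (negbTE em).
rewrite (evenE _ ej); apply: power_sum_le_top => //; have := ltn_ord j.
move: ej; rewrite /bump leq0n add1n; lia.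
Qed.

(** The diagonal terms are 1 and the others are even powers. *)
Lemma size_le_power_sum : (size X)%:R <= S (2 * t).
Proof.
rewrite -sum1_size natr_sum /S /power_sum big_seq [leRHS]big_seq.
apply: ler_sum => x xX.
rewrite (big_rem x)//= dotp_diag; last exact: X_sphere.
rewrite expr1n !mulr1 lerDl.
by apply: sumr_ge0 => y _; rewrite !mul1r exprM exprn_ge0 ?sqr_ge0.
Qed.

Lemma sphere_int_sum_dotpX :
  sphere_int n (fun z => \sum_(y <- X) dotp n y z ^+ (2 * t)) =
  (size X)%:R * even_moment n t.
Proof.
rewrite sphere_int_sum//; last by move=> y; apply: tameX; exact: tame_dotp.
rewrite -sum1_size natr_sum mulr_suml; apply: eq_big_seq => y /X_sphere Sy.
rewrite mul1r -(moment_even n n_gt0 t y y Sy).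
by apply: eq_sphere_int => z _; rewrite mulr1.
Qed.

Lemma sphere_int_sqr_sum_dotpX :
  sphere_int n (fun z => (\sum_(y <- X) dotp n y z ^+ (2 * t)) ^+ 2) =
  \sum_(x <- X) \sum_(y <- X) moment n (2 * t) (2 * t) x y.
Proof.
transitivity (sphere_int n (fun z => \sum_(x <- X) \sum_(y <- X)
    dotp n x z ^+ (2 * t) * dotp n y z ^+ (2 * t))).
  apply: eq_sphere_int => z _; rewrite expr2 mulr_suml.
  by apply: eq_bigr => x _; rewrite mulr_sumr.
rewrite sphere_int_sum//; last first.
  by move=> x; apply: tame_sum => y; exact: tame_dotpX.
by apply: eq_bigr => x _; rewrite sphere_int_sum// => y; exact: tame_dotpX.
Qed.

End averaged_kernel.

(** * The bound for approximate designs *)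

(** From 2 * (eps * sqrt q) * sqrt s <= eps^2 * q + s. *)
Lemma le_of_sqrt_bound {R : realType} (s m q eps V : R) :
  0 <= s -> 0 <= q -> 0 <= eps -> V <= q * s ->
  s - m <= eps * Num.sqrt V -> s <= 2 * m + eps ^+ 2 * q.
Proof.
move=> s0 q0 e0 Vqs smV.
have sV : Num.sqrt V <= Num.sqrt q * Num.sqrt s by rewrite -sqrtrM// ler_wsqrtr.
have := le_trans smV (ler_wpM2l e0 sV).
have := sqr_ge0 (eps * Num.sqrt q - Num.sqrt s).
have := sqr_sqrtr s0; rewrite -[in X in _ -> _ -> _ -> X](sqr_sqrtr q0).
by move: (Num.sqrt q) (Num.sqrt s) => a b; lra.
Qed.

Section design.
Context {R : realType} (d : nat) (d_gt0 : (0 < d)%N) (t : nat).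
Variables (eps : R) (X : {fset d.-tuple R}).
Hypothesis eps_gt0 : 0 < eps.
Hypothesis X_design : approximate_design eps (2 * t) X.

Let N : R := #|` X|%:R.
(* The average over X of the averaged kernel. *)
Let s := N ^- 2 * power_sum d X (2 * t) (fun=> 1).
(* The squared norm of the test polynomial is at most q * s. *)
Let q := (2 * t)%:R * (coef_bound d (2 * t) * d%:R ^+ (t - 1)) : R.

Let N_gt0 : 0 < N.
Proof. by have [X0 _ _] := X_design; rewrite ltr0n cardfs_gt0. Qed.

Let X_sphere x : x \in enum_fset X -> unit_sphere d x.
Proof. by have [_ SX _] := X_design; exact: SX. Qed.

Lemma invN_le : N^-1 <= s.
Proof.
rewrite (_ : N^-1 = N ^- 2 * N); last by field; rewrite gt_eqF.
rewrite /s ler_wpM2l ?invr_ge0 ?sqr_ge0//.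
exact: size_le_power_sum.
Qed.

(** The design property for the averaged kernel minus its integral, whose
squared norm is at most q * s by [sum_moment_le]. *)
Lemma design_power_sum_le : s <= 2 * even_moment d t + eps ^+ 2 * q.
Proof.
have [X0 SX Xd] := X_design.
pose g z := \sum_(y <- X) dotp d y z ^+ (2 * t).
pose f : mpoly d R := N^-1 *: (\sum_(y <- X) dotp_poly d y ^+ (2 * t)) -
  mpolyC d (even_moment d t).
have fE z : meval (tnth z) f = N^-1 * g z - even_moment d t.
  rewrite mevalB mevalC mevalZ raddf_sum; congr (_ * _ - _).
  by apply: eq_bigr => y _; rewrite /= rmorphXn /= meval_dotp_poly.
have tg : tame d g by apply: tame_sum => y; apply: tameX; exact: tame_dotp.
have ig : sphere_int d g = N * even_moment d t by exact: sphere_int_sum_dotpX.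
have f_deg : degree_le (2 * t) f.
  apply: degree_leB; last exact: degree_leC.
  apply: degree_leZ; apply: degree_le_sum => y.
  by apply: degree_leX; exact: degree_le_dotp_poly.
have N0 : N != 0 by rewrite gt_eqF.
have sum_f : \sum_(x <- X) meval (tnth x) f = N * (s - even_moment d t).
  rewrite (eq_bigr _ (fun x _ => fE x)) sumrB -mulr_sumr.
  rewrite (_ : \sum_(x <- X) even_moment d t = N * even_moment d t); last first.
    rewrite /N -[#|` X|]/(size X) -sum1_size natr_sum mulr_suml.
    by apply: eq_bigr => x _; rewrite mul1r.
  rewrite (_ : \sum_(x <- X) g x = power_sum d X (2 * t) (fun=> 1)); last first.
    rewrite exchange_big; apply: eq_bigr => x _; apply: eq_bigr => y _.
    by rewrite !mul1r.
  by rewrite /s; field.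
have int_f : sphere_int d (fun z => meval (tnth z) f) = 0.
  rewrite (eq_sphere_int _ _ (fun z => N^-1 * g z + - even_moment d t));
    last by move=> z _; exact: fE.
  rewrite sphere_intD//; last 2 first.
  - by apply: tameM => //; exact: tame_cst.
  - exact: tame_cst.
  by rewrite sphere_intZ// sphere_int_cst// ig; field.
have int_f2 : sphere_int d (fun z => `|meval (tnth z) f| ^+ 2) <= q * s.
  rewrite (eq_sphere_int _ _ (fun z => N ^- 2 * g z ^+ 2 +
    ((- (2 * even_moment d t * N^-1)) * g z + even_moment d t ^+ 2))); last first.
    by move=> z _; rewrite real_normK ?num_real// fE; field.
  have tg2 : tame d (fun z => g z ^+ 2) by exact: tameX.
  rewrite sphere_intD//; last 2 first.
  - by apply: tameM => //; exact: tame_cst.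
  - by apply: tameD; [apply: tameM => //|]; exact: tame_cst.
  rewrite sphere_intD//; last 2 first.
  - by apply: tameM => //; exact: tame_cst.
  - exact: tame_cst.
  rewrite sphere_intZ// (sphere_intZ _ d_gt0 (- _))// sphere_int_cst// ig.
  rewrite sphere_int_sqr_sum_dotpX//.
  have := sum_moment_le d d_gt0 X X_sphere t; rewrite -/q -/N.
  set A := \sum_(x <- X) _; set P := power_sum _ _ _ _ => AP.
  rewrite (_ : q * s = N ^- 2 * (q * P)); last by rewrite /s -/P; ring.
  rewrite (_ : _ + _ = N ^- 2 * (A - N ^+ 2 * even_moment d t ^+ 2));
    last by field.
  by rewrite ler_wpM2l ?invr_ge0 ?sqr_ge0// lerBlDl.
have := Xd f f_deg; rewrite /= sum_f.
rewrite -[\int[_]_(_ in _) _]/(sphere_int d (fun z => meval (tnth z) f)) int_f.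
rewrite subr0 -/N mulKf// => /(le_trans (ler_norm _)).
apply: le_of_sqrt_bound => //; last exact: ltW.
- by apply: le_trans invN_le; rewrite invr_ge0 ltW.
- by rewrite /q !mulr_ge0 ?coef_bound_ge0 ?exprn_ge0.
Qed.

Lemma design_card_ge :
  (2 * ((2 * t)`!%:R + (2 * t)%:R * (2 * (2 * t))`!%:R))^-1 *
    (d%:R ^+ (2 * t) / (d%:R ^+ t + eps ^+ 2 * d%:R ^+ (t - 1))) <= N.
Proof.
set K := (_ + _); set D := (_ + _).
have d0 : 0 < d%:R :> R by rewrite ltr0n.
have D0 : 0 < D.
  by rewrite ltr_pwDl ?exprn_gt0// mulr_ge0 ?sqr_ge0// exprn_ge0// ltW.
have K0 : 0 < K by rewrite ltr_pwDl ?mulr_ge0// ltr0n fact_gt0.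
rewrite -[leRHS]invrK -[leLHS]invrK lef_pV2 ?posrE ?invr_gt0//; last first.
  apply: mulr_gt0; first by rewrite invr_gt0 mulr_gt0.
  by rewrite divr_gt0// exprn_gt0.
apply: le_trans invN_le _; apply: le_trans design_power_sum_le _.
rewrite !invfM !invrK.
have dE : (d%:R ^+ t)^-1 = d%:R ^+ t / d%:R ^+ (2 * t) :> R.
  rewrite mul2n -addnn exprD invfM mulrA divff ?mul1r//.
  by rewrite expf_neq0// gt_eqF.
have := @even_moment_le R d d_gt0 t; rewrite /q /coef_bound dE /K /D.
have F1 := ler0n R (2 * t)`!; have F2 := ler0n R (2 * (2 * t))`!.
have T0 := ler0n R (2 * t).
have u0 : 0 <= d%:R ^+ t :> R by rewrite exprn_ge0 ?ltW.
have w0 : 0 <= d%:R ^+ (t - 1) :> R by rewrite exprn_ge0 ?ltW.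
have z0 : 0 <= (d%:R ^+ (2 * t))^-1 :> R by rewrite invr_ge0 exprn_ge0 ?ltW.
have e0 := sqr_ge0 eps.
move: (even_moment d t) F1 F2 T0 u0 w0 z0 e0.
move: (_ `!%:R) (_ `!%:R) (2 * t)%:R (d%:R ^+ t) (d%:R ^+ (t - 1)) (_^-1)
  (eps ^+ 2).
move=> F2 F1 T u w z e2 m F1_0 F2_0 T_0 u_0 w_0 z_0 e_0 mle.
have p1 : 0 <= F1 * (e2 * (w * z)) by rewrite !mulr_ge0.
have p2 : 0 <= T * F2 * (u * z) by rewrite !mulr_ge0.
have p3 : 0 <= T * F2 * (e2 * (w * z)) by rewrite !mulr_ge0.
lra.
Qed.

End design.

Theorem theorem6p7 (R : realType) (t : nat) (ht : (0 < t)%N) :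
  exists2 c : R, 0 < c &
    forall (d : nat) (eps : R) (X : {fset d.-tuple R}),
      (1 <= d)%N -> 0 < eps -> approximate_design eps (2 * t) X ->
      c * (d%:R ^+ (2 * t) / (d%:R ^+ t + eps ^+ 2 * d%:R ^+ (t - 1)))
        <= #|` X|%:R.
Proof.
exists (2 * ((2 * t)`!%:R + (2 * t)%:R * (2 * (2 * t))`!%:R))^-1.
  by rewrite invr_gt0 mulr_gt0// ltr_pwDl ?mulr_ge0// ltr0n fact_gt0.
by move=> d eps X d_gt0 eps_gt0 X_design; exact: design_card_ge.
Qed.
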